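(* Let $D$ be a diagram of $n$ boxes in the plane, with a fixed reading order, and let $\mathrm{StdTab}(D)$ be an ascent-compatible (nonempty) subset of $\mathrm{StdFill}(D)$. Let $\mathbf{N}_{\mathrm{StdTab}(D)}$ be the complex span of $\mathrm{StdTab}(D)$ and define linear operators $\pi_1,\dots,\pi_{n-1}$ on it by $$\pi_iT=\begin{cases}-T & \text{if } i\in \mathrm{Des}(T)\\ 0 & \text{if } i\notin \mathrm{Des}(T) \text{ and } i \text{ is attacking in } T\\ s_iT & \text{if } i\notin \mathrm{Des}(T) \text{ and } i \text{ is nonattacking in } T\end{cases}$$ for $T\in \mathrm{StdTab}(D)$. Then the operators $\{\pi_i: 1\le i\le n-1\}$ define an action of the $0$-Hecke algebra $H_n(0)$ on $\mathbf{N}_{\mathrm{StdTab}(D)}$.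
   Context: $H_n(0)$ is the $\mathbb{C}$-algebra with generators $\pi_1,\dots,\pi_{n-1}$ and relations $\pi_i^2=-\pi_i$ ($1\le i\le n-1$), $\pi_i\pi_j=\pi_j\pi_i$ ($|i-j|\ge 2$), $\pi_i\pi_{i+1}\pi_i=\pi_{i+1}\pi_i\pi_{i+1}$ ($1\le i\le n-2$). A diagram $D$ is a collection of $n$ boxes in the coordinate plane. A standard filling of $D$ is a bijective assignment of $1,\dots,n$ to the boxes of $D$; $\mathrm{StdFill}(D)$ is the set of all $n!$ standard fillings. A reading order on $D$ is a fixed total ordering of the boxes. For $T\in\mathrm{StdFill}(D)$ the reading word $\mathrm{rw}(T)$ is the permutation of $\{1,\dots,n\}$ obtained by writing the entries of $T$ in reading order from left to right, and $\mathrm{rw}(T)_r$ is its $r$th entry. $s_iT$ is the standard filling obtained by exchanging the entries $i$ and $i+1$ in $T$. Let $\mathrm{StdTab}(D)\subseteq \mathrm{StdFill}(D)$ be nonempty. For $T\in \mathrm{StdTab}(D)$, $\mathrm{Des}(T)=\{i\in\{1,\dots,n-1\}: i \text{ is to the right of } i+1 \text{ in } \mathrm{rw}(T)\}$. Elements of $\{1,\dots,n-1\}\setminus \mathrm{Des}(T)$ are ascents of $T$. An ascent $i$ of $T$ is attacking if $s_iT\notin \mathrm{StdTab}(D)$ and nonattacking if $s_iT\in \mathrm{StdTab}(D)$. $T$ has an ascent in positions $(r,s)$ if $r<s$ and $\mathrm{rw}(T)_s-\mathrm{rw}(T)_r=1$. $\mathrm{StdTab}(D)$ is ascent-compatible if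 whenever $T,T'\in \mathrm{StdTab}(D)$ both have an ascent in positions $(r,s)$, this ascent is attacking in $T$ if and only if it is attacking in $T'$. *)

(* Defs.v *)
From HB Require Import structures.
From mathcomp Require Import all_boot all_order all_algebra perm.
From mathcomp Require Import finmap monalg.
From mathcomp Require Import boolp reals.
From mathcomp Require Import complex.

Set Implicit Arguments.
Unset Strict Implicit.
Unset Printing Implicit Defensive.

Import GRing.Theory.
Local Open Scope ring_scope.
Local Open Scope quotient_scope.

(* The free associative unital K-algebra on I: the monoid algebra of the free
   monoid on I. *)
Section FreeAlgebra.
Variables (K : comNzRingType) (I : choiceType).

Definition free_alg : Type := {malg K[{fmonom I}]}.

HB.instance Definition _ := GRing.Lalgebra.on free_alg.

Fact free_alg_scalerAr (c : K) (x y : free_alg) :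
  c *: (x * y) = x * (c *: y).
Proof.
have cC (g : {malg K[{fmonom I}]}) : c%:MP * g = g * c%:MP.
  rewrite !malgM_def fgmulUg fgmulgU; apply: eq_bigr => k _.
  by rewrite mul1m mulm1 mulrC.
rewrite -[LHS](@mul_malgC _ K) -[c *: y](@mul_malgC _ K).
by rewrite mulrA cC -mulrA.
Qed.

HB.instance Definition _ :=
  GRing.Lalgebra_isAlgebra.Build K free_alg free_alg_scalerAr.

End FreeAlgebra.

HB.lock Definition free_gen (K : comNzRingType) (I : choiceType) (i : I) :
  free_alg K I := (<< fmu i >>)%R.
Canonical free_gen_unlockable := Unlockable free_gen.unlock.

(* The associative unital K-algebra A / (x - y | rel x y): the quotient of A
   by the two-sided ideal generated by the relations x = y. *)
Section Presentation.
Variables (K : comNzRingType) (A : algType K) (rel : A -> A -> Prop).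

Inductive rel_ideal : A -> Prop :=
| rel_ideal0 : rel_ideal 0
| rel_idealD x y : rel_ideal x -> rel_ideal y -> rel_ideal (x + y)
| rel_idealM a x b : rel_ideal x -> rel_ideal (a * x * b)
| rel_ideal_gen x y : rel x y -> rel_ideal (x - y).

Definition rel_idealb : {pred A} := fun x => `[< rel_ideal x >].

Lemma rel_idealP x : reflect (rel_ideal x) (x \in rel_idealb).
Proof. exact: asboolP. Qed.

Lemma rel_ideal_zmod_closed : zmod_closed rel_idealb.
Proof.
split=> [|x y /rel_idealP Ix /rel_idealP Iy]; apply/rel_idealP.
  exact: rel_ideal0.
apply: rel_idealD => //.
by rewrite -[y]mul1r -mulNr -[_ * y]mulr1; apply: rel_idealM.
Qed.

HB.instance Definition _ :=
  GRing.isZmodClosed.Build A rel_idealb rel_ideal_zmod_closed.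

Lemma rel_idealMl a x : x \in rel_idealb -> a * x \in rel_idealb.
Proof.
by move=> /rel_idealP Ix; apply/rel_idealP; rewrite -[_ * _]mulr1;
  apply: rel_idealM.
Qed.

Lemma rel_idealMr x b : x \in rel_idealb -> x * b \in rel_idealb.
Proof.
by move=> /rel_idealP Ix; apply/rel_idealP; rewrite -[x]mul1r;
  apply: rel_idealM.
Qed.

Definition alg_quot : Type := Quotient.quot rel_idealb.
HB.instance Definition _ := Choice.on alg_quot.
HB.instance Definition _ := EqQuotient.on alg_quot.
HB.instance Definition _ := GRing.Zmodule.on alg_quot.

Definition alg_proj (x : A) : alg_quot := \pi_(alg_quot) x.

Lemma alg_projP x y : reflect (alg_proj x = alg_proj y) (x - y \in rel_idealb).
Proof.
by rewrite (Quotient.idealrBE rel_idealb); apply: eqP.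
Qed.

Lemma alg_projK : cancel (repr : alg_quot -> A) alg_proj.
Proof. by move=> x; rewrite /alg_proj reprK. Qed.

Lemma alg_projD : {morph alg_proj : x y / x + y}.
Proof. by move=> x y; rewrite /alg_proj; exact: (Quotient.pi_add rel_idealb). Qed.

Definition alg_quot_mul (x y : alg_quot) : alg_quot :=
  alg_proj (repr x * repr y).
Definition alg_quot_scale (c : K) (x : alg_quot) : alg_quot :=
  alg_proj (c *: repr x).

Lemma alg_projM x y : alg_quot_mul (alg_proj x) (alg_proj y) = alg_proj (x * y).
Proof.
apply/alg_projP; set x' := repr _; set y' := repr _.
have Ix : x' - x \in rel_idealb by apply/alg_projP; rewrite alg_projK.
have Iy : y' - y \in rel_idealb by apply/alg_projP; rewrite alg_projK.
have -> : x' * y' - x * y = x' * (y' - y) + (x' - x) * y.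
  by rewrite mulrBr mulrBl addrA subrK.
by apply: rpredD; [exact: rel_idealMl | exact: rel_idealMr].
Qed.

Lemma alg_projZ c x : alg_quot_scale c (alg_proj x) = alg_proj (c *: x).
Proof.
have Ix : repr (alg_proj x) - x \in rel_idealb.
  by apply/alg_projP; rewrite alg_projK.
by apply/alg_projP; rewrite -scalerBr -[_ - _]mul1r scalerAl; exact: rel_idealMl.
Qed.

Lemma alg_quot_mulA : associative alg_quot_mul.
Proof.
move=> x y z; rewrite -[x]alg_projK -[y]alg_projK -[z]alg_projK.
by rewrite !alg_projM mulrA.
Qed.

Lemma alg_quot_mul1 : left_id (alg_proj 1) alg_quot_mul.
Proof. by move=> x; rewrite -[x]alg_projK alg_projM mul1r. Qed.

Lemma alg_quot_mulr1 : right_id (alg_proj 1) alg_quot_mul.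
Proof. by move=> x; rewrite -[x]alg_projK alg_projM mulr1. Qed.

Lemma alg_quot_mulDl : left_distributive alg_quot_mul +%R.
Proof.
move=> x y z; rewrite -[x]alg_projK -[y]alg_projK -[z]alg_projK.
by rewrite -alg_projD !alg_projM mulrDl alg_projD.
Qed.

Lemma alg_quot_mulDr : right_distributive alg_quot_mul +%R.
Proof.
move=> x y z; rewrite -[x]alg_projK -[y]alg_projK -[z]alg_projK.
by rewrite -alg_projD !alg_projM mulrDr alg_projD.
Qed.

HB.instance Definition _ := GRing.Zmodule_isPzRing.Build alg_quot
  alg_quot_mulA alg_quot_mul1 alg_quot_mulr1 alg_quot_mulDl alg_quot_mulDr.

Lemma alg_quot_scaleA a b x :
  alg_quot_scale a (alg_quot_scale b x) = alg_quot_scale (a * b) x.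
Proof. by rewrite -[x]alg_projK !alg_projZ scalerA. Qed.

Lemma alg_quot_scale1 : left_id 1 alg_quot_scale.
Proof. by move=> x; rewrite -[x]alg_projK alg_projZ scale1r. Qed.

Lemma alg_quot_scaleDr : right_distributive alg_quot_scale +%R.
Proof.
move=> c x y; rewrite -[x]alg_projK -[y]alg_projK.
by rewrite -alg_projD !alg_projZ scalerDr alg_projD.
Qed.

Lemma alg_quot_scaleDl x : {morph alg_quot_scale^~ x : a b / a + b}.
Proof.
by move=> a b; rewrite -[x]alg_projK !alg_projZ scalerDl alg_projD.
Qed.

HB.instance Definition _ := GRing.Zmodule_isLmodule.Build K alg_quot
  alg_quot_scaleA alg_quot_scale1 alg_quot_scaleDr alg_quot_scaleDl.

Lemma alg_quot_scaleAl (c : K) (x y : alg_quot) : c *: (x * y) = c *: x * y.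
Proof.
rewrite -[x]alg_projK -[y]alg_projK /GRing.scale /GRing.mul /=.
by rewrite !(alg_projZ, alg_projM) scalerAl.
Qed.

Lemma alg_quot_scaleAr (c : K) (x y : alg_quot) : c *: (x * y) = x * (c *: y).
Proof.
rewrite -[x]alg_projK -[y]alg_projK /GRing.scale /GRing.mul /=.
by rewrite !(alg_projZ, alg_projM) scalerAr.
Qed.

Lemma alg_proj_is_linear : linear alg_proj.
Proof. by move=> c x y; rewrite alg_projD -alg_projZ. Qed.

HB.instance Definition _ :=
  GRing.isLinear.Build K A alg_quot *:%R alg_proj alg_proj_is_linear.

Lemma alg_proj_is_monoid_morphism : monoid_morphism alg_proj.
Proof. by split=> // x y; rewrite -alg_projM. Qed.

HB.instance Definition _ :=
  GRing.isMonoidMorphism.Build A alg_quot alg_proj alg_proj_is_monoid_morphism.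

Lemma alg_proj_rel x y : rel x y -> alg_proj x = alg_proj y.
Proof. by move=> xy; apply/alg_projP/rel_idealP/rel_ideal_gen. Qed.

End Presentation.

(* Everything numbered from 1 in the mathematics is numbered from 0 here:
   i : 'I_n.-1 is the index usually written i + 1 of a generator. *)
Section ZeroHecke.
Variables (K : comNzRingType) (n : nat).

Local Notation p := (@free_gen K 'I_n.-1).

Inductive hecke0_rel : free_alg K 'I_n.-1 -> free_alg K 'I_n.-1 -> Prop :=
| Hecke0Quad i : hecke0_rel (p i ^+ 2) (- p i)
| Hecke0Comm (i j : 'I_n.-1) of (i.+2 <= j)%N || (j.+2 <= i)%N :
    hecke0_rel (p i * p j) (p j * p i)
| Hecke0Braid (i j : 'I_n.-1) of j = i.+1 :> nat :
    hecke0_rel (p i * p j * p i) (p j * p i * p j).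

Definition hecke0 : Type := alg_quot hecke0_rel.
HB.instance Definition _ := GRing.PzRing.on hecke0.
HB.instance Definition _ := GRing.Lmodule.on hecke0.

Lemma hecke0_rel_ideal_coef0 (x : free_alg K 'I_n.-1) :
  rel_ideal hecke0_rel x -> @mcoeff {fmonom 'I_n.-1} K (@mone _) x = 0.
Proof.
pose e : {rmorphism {malg K[{fmonom 'I_n.-1}]} -> K} := @mcoeff _ _ (@mone _).
have ep i : e (p i) = 0.
  by rewrite unlock /= mcoeffU; case: eqP => // /(congr1 (@fdeg _)); rewrite fdegU fdeg1.
have eM (u v : free_alg K 'I_n.-1) : e (u * v) = e u * e v by exact: rmorphM.
have eB (u v : free_alg K 'I_n.-1) : e (u - v) = e u - e v by exact: rmorphB.
have eN (u : free_alg K 'I_n.-1) : e (- u) = - e u by exact: rmorphN.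
have e0 : e 0 = 0 by exact: rmorph0.
rewrite -[LHS]/(e x); move: (e : _ -> K) ep eM eB eN e0 => {e} e ep eM eB eN e0.
elim=> {x} [|x y _ ex _ ey|a x b _ ex|x y xy] //.
- by rewrite -[y]opprK eB eN ex ey oppr0 subr0.
- by rewrite (eM (a * x)) (eM a) ex mulr0 mul0r.
have eMM (u v u' v' : free_alg K 'I_n.-1) :
    e v = 0 -> e v' = 0 -> e (u * v) = e (u' * v').
  by move=> ev ev'; rewrite (eM u v) (eM u' v') ev ev' !mulr0.
suff exy : e x = e y by rewrite (eB x y) exy subrr.
case: xy => [i|i j _|i j _]; [|exact: eMM|exact: eMM].
by rewrite expr2 (eM (p i)) (eN (p i)) ep mul0r oppr0.
Qed.

Lemma hecke0_oner_neq0 : (1 : hecke0) != 0.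
Proof.
apply/eqP => h10.
have /alg_projP/rel_idealP : alg_proj hecke0_rel 1 = alg_proj hecke0_rel 0.
  by rewrite [RHS]linear0; exact: h10.
rewrite subr0 => /hecke0_rel_ideal_coef0.
by rewrite mcoeff1 eqxx => /eqP; rewrite oner_eq0.
Qed.

HB.instance Definition _ :=
  GRing.PzSemiRing_isNonZero.Build hecke0 hecke0_oner_neq0.
HB.instance Definition _ := GRing.Lmodule_isLalgebra.Build K hecke0
  (@alg_quot_scaleAl K _ hecke0_rel).
HB.instance Definition _ := GRing.Lalgebra_isAlgebra.Build K hecke0
  (@alg_quot_scaleAr K _ hecke0_rel).

Definition hecke0_gen (i : 'I_n.-1) : hecke0 := alg_proj hecke0_rel (p i).

End ZeroHecke.

Definition is_algebra_action (K : comNzRingType) (A : algType K)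
    (V : lmodType K) (act : A -> V -> V) : Prop :=
  [/\ forall a, linear (act a),
      forall v, linear (act^~ v),
      forall v, act 1 v = v
    & forall a b v, act (a * b) v = act a (act b v)].

Definition is_total_order (T : eqType) (r : rel T) : Prop :=
  [/\ reflexive r, antisymmetric r, transitive r & total r].

Section Fillings.
(* A box is recorded by the position of its lower left corner. *)
Variables (R : realType) (n : nat) (D : {fset R * R}).

Definition filling := {ffun D -> 'I_n}.
HB.instance Definition _ := Finite.on filling.

Implicit Types (T : filling) (i : 'I_n.-1).

Definition std_fill : {set filling} :=
  [set T : filling | injectiveb T & [forall k, k \in codom T]].

Definition entry i : 'I_n := widen_ord (leq_pred n) i.

Fact entryS_subproof i : (i.+1 < n)%N.
Proof. by rewrite -ltn_predRL. Qed.

Definition entryS i : 'I_n := Ordinal (entryS_subproof i).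

Definition swap i T : filling := [ffun b => tperm (entry i) (entryS i) (T b)].

Variable ro : rel D.

Definition rw T : seq 'I_n := [seq T b | b <- sort ro (enum {: D})].

Definition Des T : {set 'I_n.-1} :=
  [set i | (index (entryS i) (rw T) < index (entry i) (rw T))%N].

(* T has an ascent in positions (r, s), and that ascent is i. *)
Definition ascent_in T (r s : nat) i : Prop :=
  [/\ (r < s)%N, onth (rw T) r = Some (entry i)
    & onth (rw T) s = Some (entryS i)].

Variable S : {set filling}.

Definition attacking T i : bool := (i \notin Des T) && (swap i T \notin S).

Definition ascent_compatible : Prop :=
  forall T T' r s i i', T \in S -> T' \in S ->
    ascent_in T r s i -> ascent_in T' r s i' ->
    attacking T i <-> attacking T' i'.

End Fillings.

Section TabModule.
Variables (K : comNzRingType) (R : realType) (n : nat) (D : {fset R * R}).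
Variables (ro : rel D) (S : {set filling n D}).

Definition tab_module : Type := {ffun {T : filling n D | T \in S} -> K^o}.
HB.instance Definition _ := GRing.Lmodule.on tab_module.

(* The basis vector attached to T; it is only meaningful for T \in S. *)
Definition tab_vec (T : filling n D) : tab_module :=
  [ffun U : {T | T \in S} => (val U == T)%:R].

Definition pi_tab (i : 'I_n.-1) (T : filling n D) : tab_module :=
  if i \in Des ro T then - tab_vec T
  else if attacking ro S T i then 0
  else tab_vec (swap i T).

Definition pi_op (i : 'I_n.-1) (v : tab_module) : tab_module :=
  \sum_(U : {T : filling n D | T \in S}) v U *: pi_tab i (val U).

Lemma pi_op_is_linear i : linear (pi_op i).
Proof.
move=> c u v; rewrite /pi_op scaler_sumr -big_split /=; apply: eq_bigr => U _.
by rewrite !ffunE scalerDl scalerA.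
Qed.

HB.instance Definition _ i :=
  GRing.isLinear.Build K tab_module tab_module *:%R (pi_op i)
    (pi_op_is_linear i).

Lemma pi_op_vec i T : T \in S -> pi_op i (tab_vec T) = pi_tab i T.
Proof.
move=> ST; rewrite /pi_op (bigD1 (Sub T ST)) //= big1 ?addr0 => [|U neU].
  by rewrite ffunE eqxx scale1r.
by rewrite ffunE -[T](SubK {T | T \in S} ST) val_eqE (negPf neU) scale0r.
Qed.

Lemma tab_vec_span (v : tab_module) :
  v = \sum_(U : {T : filling n D | T \in S}) v U *: tab_vec (val U).
Proof.
apply/ffunP => W; rewrite sum_ffunE (bigD1 W) //= big1 ?addr0 => [|U neU].
  by rewrite !ffunE eqxx [_ *: _]mulr1.
by rewrite !ffunE val_eqE eq_sym (negPf neU) scaler0.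
Qed.

End TabModule.

(* Main.v *)
(** Since [StdTab] is ascent-compatible, whether an ascent [i] of [T] is
    attacking depends only on the positions of [i] and [i+1] in the reading
    word.  Hence [pi_i] acts on [T] through the positions [(a, b)] of [i] and
    [i+1] alone: it gives [- T] if [b < a], it kills [T] if [(a, b)] is an
    attacking pair, and it exchanges [a] and [b] otherwise.  The commutation
    relation holds because the two operators involve disjoint pairs of
    positions, and the braid relation is checked on the positions [(a, b, c)]
    of [i], [i+1], [i+2]: in each relative order, the two sides meet the same
    pairs of positions. *)
Require Import Defs.
From HB Require Import structures.
From mathcomp Require Import fingroup.
From mathcomp Require Import all_boot all_order all_algebra perm.
From mathcomp Require Import finmap monalg.
From mathcomp Require Import boolp reals.
From mathcomp Require Import complex.
From mathcomp Require Import zify.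

Set Implicit Arguments.
Unset Strict Implicit.
Unset Printing Implicit Defensive.

Import GRing.Theory.
Local Open Scope ring_scope.

(** * Free algebras acting through arbitrary linear operators *)

Section FreeAlgebraAction.
Variables (K : comNzRingType) (I : choiceType) (V : lmodType K).
Variable f : I -> {linear V -> V}.

(** With [foldr] the last letter acts first, so concatenation of words becomes composition in the
    order that a left action requires. *)
Definition word_act (w : seq I) (v : V) : V := foldr (fun i => f i) v w.

Lemma word_act_is_linear w : linear (word_act w).
Proof.
elim: w => [|i w IHw] c u v //.
by rewrite -[LHS]/(f i (word_act w _)) IHw linearP.
Qed.

HB.instance Definition _ w :=
  GRing.isLinear.Build K V V *:%R (word_act w) (word_act_is_linear w).

Lemma word_act_cat w1 w2 v :
  word_act (w1 ++ w2) v = word_act w1 (word_act w2 v).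
Proof. by rewrite /word_act foldr_cat. Qed.

Definition free_act (x : free_alg K I) (v : V) : V :=
  \sum_(m <- msupp x) mcoeff m x *: word_act m v.

(** Words outside the support have coefficient zero. Enlarging the index set lets sums over
    different supports be compared over a common one. *)
Lemma free_actEw (d : {fset {fmonom I}}) (x : free_alg K I) v :
  (msupp x `<=` d)%fset -> free_act x v = \sum_(m <- d) mcoeff m x *: word_act m v.
Proof.
move=> le_xd; rewrite /free_act (big_fset_incl _ le_xd) // => m _ m_x.
by rewrite (mcoeff_outdom m_x) scale0r.
Qed.

Lemma free_act_is_linear v : linear (free_act^~ v).
Proof.
move=> c x y; pose d := (msupp x `|` msupp y)%fset.
have le_xd : (msupp x `<=` d)%fset by exact: fsubsetUl.
have le_yd : (msupp y `<=` d)%fset by exact: fsubsetUr.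
rewrite (free_actEw v le_xd) (free_actEw v le_yd) (@free_actEw d).
  rewrite scaler_sumr -big_split /=; apply: eq_bigr => m _.
  by rewrite mcoeffD mcoeffZ scalerDl scalerA.
apply: fsubset_trans (msuppD_le _ _) _.
by rewrite fsubUset le_yd (fsubset_trans (msuppZ_le _ _)).
Qed.

Definition free_act_at v (x : free_alg K I) : V := free_act x v.
HB.instance Definition _ v :=
  GRing.isLinear.Build K (free_alg K I) V *:%R (free_act_at v)
    (free_act_is_linear v).

Lemma free_actU c (m : {fmonom I}) v :
  free_act (<< c *g m >> : {malg K[{fmonom I}]}) v = c *: word_act m v.
Proof. by rewrite (free_actEw v msuppU_le) big_seq_fset1 mcoeffUU. Qed.

Lemma free_act_gen i v : free_act (free_gen K i) v = f i v.
Proof. by rewrite unlock free_actU scale1r fmU. Qed.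

Lemma free_act1 v : free_act 1 v = v.
Proof. by rewrite [LHS]free_actU scale1r fm1. Qed.

Lemma free_actM (x y : free_alg K I) v :
  free_act (x * y) v = free_act x (free_act y v).
Proof.
have -> : x * y = \sum_(k1 <- msupp x) \sum_(k2 <- msupp y)
  (<< mcoeff k1 x * mcoeff k2 y *g mmul k1 k2 >> : {malg K[{fmonom I}]}).
  exact: malgME.
rewrite -[LHS]/(free_act_at v _) linear_sum; apply: eq_bigr => k1 _.
rewrite linear_sum [free_act y v]/free_act linear_sum scaler_sumr.
apply: eq_bigr => k2 _.
by rewrite [LHS]free_actU fmM word_act_cat linearZ scalerA.
Qed.

Lemma free_act_is_action : is_algebra_action free_act.
Proof.
split=> [x c u v|v|v|x y v]; [|exact: free_act_is_linear|exact: free_act1|exact: free_actM].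
rewrite /free_act scaler_sumr -big_split /=; apply: eq_bigr => m _.
by rewrite linearP scalerDr !scalerA mulrC.
Qed.

End FreeAlgebraAction.

(** * Descent of an action to a quotient by relations *)

Section QuotientAction.
Variables (K : comNzRingType) (A : algType K) (rel : A -> A -> Prop).
Variables (V : lmodType K) (act : A -> V -> V).
Hypothesis act_action : is_algebra_action act.
Hypothesis act_rel : forall x y, rel x y -> act x =1 act y.

(** Induction on the ideal, with [v] kept general: in [a * x * b] the factor [x] is applied to
    [act b v], not to [v]. *)
Lemma act_rel_ideal x v : rel_ideal rel x -> act x v = 0.
Proof.
have [actlin_r actlin_l _ actM] := act_action.
pose L u : {linear A -> V} := HB.pack (act^~ u)
  (GRing.isLinear.Build K A V *:%R _ (actlin_l u)).
pose M a : {linear V -> V} := HB.pack (act a)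
  (GRing.isLinear.Build K V V *:%R _ (actlin_r a)).
move=> Ix; elim: Ix v => {x} [|x y _ IHx _ IHy|a x b _ IHx|x y xy] v.
- exact: (linear0 (L v)).
- by rewrite -[LHS]/(L v _) linearD /= IHx IHy addr0.
- by rewrite !actM IHx -[LHS]/(M a _) linear0.
- by rewrite -[LHS]/(L v _) linearB /= (act_rel xy) subrr.
Qed.

Definition quot_act (a : alg_quot rel) : V -> V := act (repr a).

(** The chosen representative differs from [x] by an element of the ideal, which acts as zero. *)
Lemma quot_act_proj x : quot_act (alg_proj rel x) =1 act x.
Proof.
move=> v; have [_ actlin_l _ _] := act_action.
pose L : {linear A -> V} := HB.pack (act^~ v)
  (GRing.isLinear.Build K A V *:%R _ (actlin_l v)).
apply/eqP; rewrite -subr_eq0 -[act x v]/(L x) -[quot_act _ _]/(L _) -linearB.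
apply/eqP/act_rel_ideal.
by apply/rel_idealP/alg_projP; rewrite alg_projK.
Qed.

(* [is_algebra_action] does not apply to [alg_quot rel], which is a ring with
   scalars but may be trivial, hence not an [algType]. *)
Lemma quot_act_is_action :
  [/\ forall a, linear (quot_act a),
      forall v, linear (quot_act^~ v),
      forall v, quot_act 1 v = v
    & forall a b v, quot_act (a * b) v = quot_act a (quot_act b v)].
Proof.
have [actlin_r actlin_l act1 actM] := act_action.
split=> [a|v c a b|v|a b v]; first exact: actlin_r.
- rewrite -[a]alg_projK -[b]alg_projK -linearP !quot_act_proj.
  exact: actlin_l.
- by rewrite quot_act_proj.
- by rewrite -[a]alg_projK -[b]alg_projK -rmorphM !quot_act_proj.
Qed.

End QuotientAction.

(** * The 0-Hecke relations on tableaux *)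

Section TabAction.
Variables (K : comNzRingType) (R : realType) (n : nat) (D : {fset R * R}).
Variables (ro : rel D) (S : {set filling n D}).
Hypothesis S_std : S \subset std_fill n D.
Hypothesis S_compat : ascent_compatible ro S.

Implicit Types (T : filling n D) (i j : 'I_n.-1) (k : 'I_n).

Local Notation vec := (@tab_vec K R n D S).
Local Notation pi := (@pi_op K R n D ro S).

(** For a missing entry [index] would return the length of the word; [mem_rw] excludes this for [T]
    in [S]. *)
Definition pos T k : nat := index k (rw ro T).

Lemma mem_rw T k : T \in S -> k \in rw ro T.
Proof.
move=> /(subsetP S_std); rewrite inE => /andP[_ /forallP/(_ k)].
move=> /codomP[b ->]; apply: map_f.
by rewrite mem_sort mem_enum.
Qed.

Lemma pos_inj T : T \in S -> injective (pos T).
Proof. by move=> ST k k' /index_inj-> //; apply: mem_rw. Qed.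

(** Swapping relabels the reading word by an injective map, which preserves indices, and a
    transposition is its own inverse. *)
Lemma pos_swap i T k :
  pos (swap i T) k = pos T (tperm (entry i) (entryS i) k).
Proof.
rewrite /pos -[RHS](index_map (@perm_inj _ (tperm (entry i) (entryS i)))).
rewrite tpermK; congr index; rewrite /rw -map_comp.
by apply: eq_map => b; rewrite ffunE.
Qed.

Lemma entry_neqS i : entry i != entryS i.
Proof. by rewrite -val_eqE /= neq_ltn ltnSn. Qed.

Lemma pos_swap_entry i T : pos (swap i T) (entry i) = pos T (entryS i).
Proof. by rewrite pos_swap tpermL. Qed.

Lemma pos_swap_entryS i T : pos (swap i T) (entryS i) = pos T (entry i).
Proof. by rewrite pos_swap tpermR. Qed.

Lemma pos_swap_out i T k :
  k != entry i -> k != entryS i -> pos (swap i T) k = pos T k.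
Proof. by move=> ki kSi; rewrite pos_swap tpermD // eq_sym. Qed.

Lemma ascent_inP T i : T \in S ->
  (pos T (entry i) < pos T (entryS i))%N ->
  ascent_in ro T (pos T (entry i)) (pos T (entryS i)) i.
Proof.
move=> ST lt_i; have nthE k : onth (rw ro T) (pos T k) = Some k.
  by rewrite onthE (nth_map k) ?index_mem ?nth_index ?mem_rw.
by split; rewrite ?nthE.
Qed.

(** One witness in [S] is enough: compatibility carries the attack over to every tableau of [S] with
    an ascent in these positions. *)
Definition attacking_pos (a b : nat) : Prop :=
  exists T i, [/\ T \in S, ascent_in ro T a b i & attacking ro S T i].

Lemma attacking_posP T i : T \in S ->
  (pos T (entry i) < pos T (entryS i))%N ->
  attacking ro S T i = `[< attacking_pos (pos T (entry i)) (pos T (entryS i)) >].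
Proof.
move=> ST lt_i; have asc := ascent_inP ST lt_i; apply/idP/asboolP => [att|].
  by exists T, i.
case=> T' [i' [ST' asc' att']].
exact/(S_compat ST ST' asc asc').
Qed.

(** The last case records that [swap i T] lies in [S], so that [piP] can be applied again when
    operators are composed. *)
Variant pi_spec i T : tab_module K S -> Type :=
| PiDescent of (pos T (entryS i) < pos T (entry i))%N : pi_spec i T (- vec T)
| PiAttacking of (pos T (entry i) < pos T (entryS i))%N
    & attacking_pos (pos T (entry i)) (pos T (entryS i)) : pi_spec i T 0
| PiNonattacking of (pos T (entry i) < pos T (entryS i))%N
    & ~ attacking_pos (pos T (entry i)) (pos T (entryS i)) & swap i T \in S :
    pi_spec i T (vec (swap i T)).

Lemma piP i T : T \in S -> pi_spec i T (pi i (vec T)).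
Proof.
move=> ST; rewrite pi_op_vec // /pi_tab inE -/(pos T _) -/(pos T _).
case: ltngtP => [lt_i|lt_i|/(pos_inj ST) eq_i]; first exact: PiDescent.
- rewrite attacking_posP //; case: asboolP => att; first exact: PiAttacking.
  apply: PiNonattacking => //.
  move: att => /asboolPn; rewrite -attacking_posP // /attacking inE.
  by rewrite -/(pos T _) -/(pos T _) ltnNge (ltnW lt_i) /= negbK.
- by have := entry_neqS i; rewrite eq_i eqxx.
Qed.

Lemma pi_opN i v : pi i (- v) = - pi i v.
Proof. exact: linearN. Qed.

Lemma pi_op0 i : pi i 0 = 0.
Proof. exact: linear0. Qed.

Lemma pi_quad i T : T \in S -> pi i (pi i (vec T)) = - pi i (vec T).
Proof.
move=> ST; case: (piP i ST) => [lt_i|lt_i att|lt_i natt SiT].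
- by rewrite pi_opN; case: (piP i ST) => // *; lia.
- by rewrite pi_op0 oppr0.
(* The swap has exchanged the two positions, so [i] is now a descent and only the sign case
   survives. *)
- by case: (piP i SiT) => //; rewrite pos_swap_entry pos_swap_entryS; lia.
Qed.

Lemma swap_comm i j T :
  (i.+2 <= j)%N || (j.+2 <= i)%N -> swap i (swap j T) = swap j (swap i T).
Proof.
move=> far; apply/ffunP => b; rewrite !ffunE.
have neq : [/\ entry i != entry j, entry i != entryS j,
  entryS i != entry j & entryS i != entryS j].
  by rewrite -!val_eqE /=; split; lia.
case: neq => n1 n2 n3 n4.
have conj_eq : (tperm (entry j) (entryS j) ^ tperm (entry i) (entryS i)
    = tperm (entry j) (entryS j))%g.
  by rewrite tpermJ !tpermD.
by rewrite -!permM conjgC conj_eq.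
Qed.

Lemma swap_braid i j T : j = i.+1 :> nat ->
  swap i (swap j (swap i T)) = swap j (swap i (swap j T)).
Proof.
move=> ji; have eij : entry j = entryS i by apply: val_inj.
have nac : entry i != entryS j by rewrite -val_eqE /=; lia.
have := entry_neqS i; have := entry_neqS j; rewrite eij => nbc nab.
(* Both conjugates are the transposition of the outer entries [entry i] and [entryS j]; expanding
   them gives the braid relation. *)
have conj_eq : (tperm (entryS i) (entryS j) ^ tperm (entry i) (entryS i)
    = tperm (entry i) (entryS i) ^ tperm (entryS i) (entryS j))%g.
  by rewrite !tpermJ tpermL tpermR !tpermD // eq_sym.
apply/ffunP => b; rewrite !ffunE eij -!permM.
by move: conj_eq; rewrite !conjgE !tpermV !mulgA => ->.
Qed.

(* Three positions are never in cyclic order: with the two-term case, this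
   discards every choice of relative order that is inconsistent. *)
Ltac pi_cases posE :=
  repeat (match goal with
    |- context [@pi_op _ _ _ _ _ _ ?k (@tab_vec _ _ _ _ _ ?U)] =>
      case: (@piP k U ltac:(assumption)) end;
  rewrite ?posE ?pi_opN ?pi_op0 ?opprK => *;
  try solve
    [ contradiction
    | rewrite ?oppr0; reflexivity
    | match goal with H1 : is_true (?a < ?b)%N, H2 : is_true (?b < ?a)%N |- _ =>
        by move: (ltn_trans H1 H2); rewrite ltnn
      end
    | match goal with H1 : is_true (?a < ?b)%N, H2 : is_true (?b < ?c)%N,
          H3 : is_true (?c < ?a)%N |- _ =>
        by move: (ltn_trans (ltn_trans H1 H2) H3); rewrite ltnn
      end ]).

Lemma pi_comm i j T : T \in S -> (i.+2 <= j)%N || (j.+2 <= i)%N ->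
  pi i (pi j (vec T)) = pi j (pi i (vec T)).
Proof.
move=> ST far.
have : [/\ entry i != entry j, entry i != entryS j,
  entryS i != entry j & entryS i != entryS j].
  by rewrite -!val_eqE /=; split; lia.
case=> n1 n2 n3 n4.
have posj T' : (pos (swap i T') (entry j) = pos T' (entry j))
    * (pos (swap i T') (entryS j) = pos T' (entryS j)).
  by rewrite !pos_swap_out // eq_sym.
have posi T' : (pos (swap j T') (entry i) = pos T' (entry i))
    * (pos (swap j T') (entryS i) = pos T' (entryS i)).
  by rewrite !pos_swap_out.
(* Neither swap moves the entries of the other index, so each operator meets the same case in either
   order. Only the case of two nonattacking ascents is left open. *)
pi_cases (posi, posj).
by rewrite swap_comm.
Qed.

(** When [a < b < c], the left side meets the pairs (a, b), (a, c), (b, c) and the right side meets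
    them in reverse order. Both vanish if one pair is attacking; otherwise [swap_braid] applies. *)
Lemma pi_braid i j T : T \in S -> j = i.+1 :> nat ->
  pi i (pi j (pi i (vec T))) = pi j (pi i (pi j (vec T))).
Proof.
move=> ST ji; have eij : entry j = entryS i by apply: val_inj.
have nac : entry i != entryS j by rewrite -val_eqE /=; lia.
have posi T' : (pos (swap i T') (entry i) = pos T' (entryS i))
    * (pos (swap i T') (entryS i) = pos T' (entry i))
    * (pos (swap i T') (entryS j) = pos T' (entryS j)).
  by rewrite pos_swap_entry pos_swap_entryS pos_swap_out // -?eij 1?eq_sym
    // entry_neqS.
have posj T' : (pos (swap j T') (entry i) = pos T' (entry i))
    * (pos (swap j T') (entryS i) = pos T' (entryS j))
    * (pos (swap j T') (entryS j) = pos T' (entryS i)).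
  by rewrite -eij pos_swap_entry pos_swap_entryS pos_swap_out // eij entry_neqS.
pi_cases (eij, posi, posj).
by rewrite swap_braid.
Qed.

End TabAction.

(** * The resulting action of the 0-Hecke algebra *)

Section HeckeAction.
Variables (K : comNzRingType) (R : realType) (n : nat) (D : {fset R * R}).
Variables (ro : rel D) (S : {set filling n D}).
Hypothesis S_std : S \subset std_fill n D.
Hypothesis S_compat : ascent_compatible ro S.

Lemma tab_vec_ext (f g : {linear tab_module K S -> tab_module K S}) :
  (forall T, T \in S -> f (tab_vec K S T) = g (tab_vec K S T)) -> f =1 g.
Proof.
move=> fg v; rewrite [v]tab_vec_span !linear_sum; apply: eq_bigr => U _.
by rewrite !linearZ fg // (valP U).
Qed.

Definition tab_act := @free_act K 'I_n.-1 (tab_module K S) (@pi_op K R n D ro S).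

Lemma tab_act_is_action : is_algebra_action tab_act.
Proof. exact: free_act_is_action. Qed.

Lemma tab_act_gen i v : tab_act (free_gen K i) v = pi_op ro i v.
Proof. exact: free_act_gen. Qed.

Lemma tab_act_hecke0_rel x y : hecke0_rel x y -> tab_act x =1 tab_act y.
Proof.
have [act_lin _ _ actM] := tab_act_is_action.
pose L a : {linear tab_module K S -> tab_module K S} := HB.pack (tab_act a)
  (GRing.isLinear.Build K _ _ *:%R _ (act_lin a)).
move=> xy; apply: (@tab_vec_ext (L x) (L y)) => T ST /=.
case: xy => [i|i j far|i j ji].
(* The sign sits on the algebra element, so linearity in that argument is used. *)
- have actN a v : tab_act (- a) v = - tab_act a v.
    exact: (linearN (@free_act_at K _ _ (@pi_op K R n D ro S) v)).
  by rewrite expr2 actM actN !tab_act_gen; exact: pi_quad.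
- by rewrite [LHS]actM [RHS]actM !tab_act_gen; exact: pi_comm.
- rewrite 2![LHS]actM 2![RHS]actM !tab_act_gen; exact: pi_braid.
Qed.

End HeckeAction.

Theorem theorem3p5 (R : realType) (n : nat) (D : {fset R * R}) (ro : rel D)
    (StdTab : {set filling n D}) :
  #|` D| = n ->
  is_total_order ro ->
  StdTab != set0 ->
  StdTab \subset std_fill n D ->
  ascent_compatible ro StdTab ->
  exists act : hecke0 R[i] n -> tab_module R[i] StdTab -> tab_module R[i] StdTab,
    is_algebra_action act /\
    forall (i : 'I_n.-1) (v : tab_module R[i] StdTab),
      act (hecke0_gen R[i] i) v = pi_op ro i v.
Proof.
move=> _ _ _ S_std S_compat.
have act_action := tab_act_is_action R[i] ro StdTab.
have act_rel := tab_act_hecke0_rel (K := R[i]) S_std S_compat.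
exists (@quot_act _ _ _ _ (tab_act (K := R[i]) ro (S := StdTab))); split.
  (* The algebra structure of [hecke0] is that of the quotient, so the four laws are
     [is_algebra_action] by conversion. *)
  exact: quot_act_is_action act_action act_rel.
move=> i v; rewrite (quot_act_proj act_action act_rel).
exact: tab_act_gen.
Qed.
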